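(* Let $\mathbf E=(E,\mathcal E)$ be a binary relational system which is involutive, reflexive, and has a compact and normal structure. Let $\mathcal A$ be a family of subsets of $E$, down-directed with respect to inclusion, such that $\mathbf E_{\restriction A}$ is a one-local retract of $\mathbf E$ for every $A\in\mathcal A$. Then $\mathbf E_{\restriction \bigcap\mathcal A}$ is a one-local retract of $\mathbf E$.
   Context: A binary relational system is a pair $\mathbf E=(E,\mathcal E)$ where $E$ is a set and $\mathcal E$ is a set of binary relations on $E$ (subsets of $E\times E$). For a relation $r$, $r^{-1}=\{(x,y):(y,x)\in r\}$. $\mathbf E$ is reflexive if every $r\in\mathcal E$ contains $\{(x,x):x\in E\}$; it is involutive if for every $r$, $r\in\mathcal E$ iff $r^{-1}\in\mathcal E$. An endomorphism of $\mathbf E$ is a map $f:E\to E$ such that $(x,y)\in r$ implies $(f(x),f(y))\in r$ for all $r\in\mathcal E$. For $x\in E$, $r\in\mathcal E$, the ball of center $x$ and radius $r$ is $B(x,r)=\{y\in E:(x,y)\in r\}$. $\hat{\mathcal B}_{\mathbf E}$ is the set of all intersections of families of balls $B(x,r)$ with $x\in E$, $r\in\mathcal E$ (the empty family gives $E$). For $A\subseteq E$, the diameter is $\delta_{\mathbf E}(A)=\{r\in\mathcal E:A\times A\subseteq r\}$ and the radius is $r_{\mathbf E}(A)=\{r\in\mathcal E:A\subseteq B(x,r)\text{ for some }x\in A\}$. $A$ is equally centered if $r_{\mathbf E}(A)=\delta_{\mathbf E}(A)$. $\mathbf E$ has a normal structure if no $A\in\hat{\mathcal B}_{\mathbf E}$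 distinct from a singleton is equally centered. $\mathbf E$ has a compact structure if every family of balls (with radii in $\mathcal E$) all of whose finite subfamilies have nonempty intersection has nonempty intersection. For $A\subseteq E$ the restriction of $\mathbf E$ to $A$ is $\mathbf E_{\restriction A}=(A,\{r\cap(A\times A):r\in\mathcal E\})$. A retraction of a system is an endomorphism $g$ with $g\circ g=g$; the restriction to its image is called a retract of the system. $\mathbf E_{\restriction A}$ is a one-local retract of $\mathbf E$ if for every $x\in E$, $\mathbf E_{\restriction A}$ is a retract of $\mathbf E_{\restriction A\cup\{x\}}$. *)

(* Defs.v *)
From mathcomp Require Import all_boot all_classical.

Set Implicit Arguments.
Unset Strict Implicit.
Unset Printing Implicit Defensive.

Local Open Scope classical_set_scope.

(* The base set E is a subset of an ambient type U rather than a type, so that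
   restrictions of a system on U are again systems on U, and can be compared
   with the ordinary equality. *)
Record brs (U : Type) := Brs {
  carrier : set U;
  rels : set (set (U * U));
  rels_sub : forall r, rels r -> r `<=` carrier `*` carrier }.

Section BinaryRelationalSystem.
Variable U : Type.
Implicit Types (E F : brs U) (A B : set U) (r : set (U * U)).
Implicit Types (FF GG : set (set U)) (f g : U -> U).

Definition rel_reflexive E : Prop :=
  forall r, rels E r -> forall x, carrier E x -> r (x, x).

Definition rel_involutive E : Prop :=
  forall r, rels E r <-> rels E (r^-1)%relation.

(* Maps U -> U stand for maps E -> E: their values outside of E are irrelevant
   to the predicates below. *)
Definition endomorphism E f : Prop :=
  set_fun (carrier E) (carrier E) f /\
  forall r, rels E r -> forall x y, r (x, y) -> r (f x, f y).

Definition rball E (x : U) r : set U := [set y | carrier E y /\ r (x, y)].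

Definition balls E : set (set U) :=
  [set B | exists x r, [/\ carrier E x, rels E r & B = rball E x r]].

(* Intersection relative to the base set: the empty family gives E, whereas
   \bigcap would give the whole ambient type. *)
Definition meet_in E FF : set U := carrier E `&` \bigcap_(B in FF) B.

Definition ball_meets E : set (set U) :=
  [set A | exists2 FF, FF `<=` balls E & A = meet_in E FF].

Definition diameter E A : set (set (U * U)) :=
  [set r | rels E r /\ A `*` A `<=` r].

Definition radius E A : set (set (U * U)) :=
  [set r | rels E r /\ exists2 x, A x & A `<=` rball E x r].

Definition equally_centered E A : Prop := radius E A = diameter E A.

Definition normal_structure E : Prop :=
  forall A, ball_meets E A -> ~ (exists x, A = [set x]) ->
    ~ equally_centered E A.

Definition compact_structure E : Prop :=
  forall FF, FF `<=` balls E ->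
    (forall GG, finite_set GG -> GG `<=` FF -> meet_in E GG !=set0) ->
    meet_in E FF !=set0.

Lemma restriction_sub E A r :
  [set s `&` (A `*` A) | s in rels E] r -> r `<=` A `*` A.
Proof. by case=> s _ <-; exact: subIsetr. Qed.

Definition restriction E A : brs U := Brs (@restriction_sub E A).

Definition retraction E g : Prop :=
  endomorphism E g /\ forall x, carrier E x -> g (g x) = g x.

Definition retract F E : Prop :=
  exists2 g, retraction E g & F = restriction E (g @` carrier E).

Definition one_local_retract E A : Prop :=
  forall x, carrier E x ->
    retract (restriction E A) (restriction E (A `|` [set x])).

Definition down_directed FF : Prop :=
  forall A B, FF A -> FF B -> exists2 C, FF C & C `<=` A `&` B.

End BinaryRelationalSystem.

(* Main.v *)
(* E restricted to A is a one-local retract of E iff balls centered in A that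
   share a point of E share a point of A.  For a chain of such sets A, take by
   compactness and Zorn's lemma a minimal monotone family of nonempty sets D(A),
   each the trace on A of balls centered in A, inside a given intersection of
   balls centered in the intersection of the chain.  Minimality forces D(A) to
   be equally centered, so normality makes all D(A) one and the same singleton.
   A directed family reduces to chains: index it by finite sets through a
   monotone net, and show the claim for arbitrary index sets from finite ones
   and unions of chains. *)

Require Import Defs.
From mathcomp Require Import all_boot all_classical.
From mathcomp Require Import finmap.

Local Open Scope classical_set_scope.

(** * Induction on index sets through finite sets and chains *)

(** Hilbert's hotel: along an injective sequence [g] in [A], the map [h] sends [g 0] to [x] and each
    [g n.+1] to [g n], and fixes every other point. *)
Lemma infinite_setU1_image {T : Type} (A : set T) (x : T) :
  infinite_set A -> exists h : T -> T, h @` A = x |` A.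
Proof.
move=> /infiniteP/card_leP[f].
have [g gA ginj] : exists2 g : nat -> T, (forall n, A (g n)) & injective g.
  exists (fun n => val (f (SigSub (mem_set (I : [set: nat] n))))) => [n|m n].
    exact/set_mem/valP.
  by move=> /val_inj e; have [] := @inj _ _ _ f _ _ (in_setT _) (in_setT _) e.
pose h y := if pselect (y = g 0) then x else
  if pselect (exists n, y = g n.+1) is left e then g (projT1 (cid e)) else y.
exists h; apply/seteqP; split.
  move=> _ [y Ay <-]; rewrite /h; case: pselect => [?|?]; first by left.
  by case: pselect => [e|?]; right; first exact: gA.
move=> y [->|Ay]; first by exists (g 0) => //; rewrite /h; case: pselect.
have [[n ->]|nex] := pselect (exists n, y = g n).
  exists (g n.+1) => //; rewrite /h.
  case: pselect => [/ginj //|?]; case: pselect => [e|[]]; last by exists n.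
  by case: (cid e) => /= m /ginj[->].
exists y => //; rewrite /h; case: pselect => [yg|?].
  by case: nex; exists 0.
by case: pselect => // -[n yg]; case: nex; exists n.+1.
Qed.

(* Zorn's lemma is applied to the sets J all of whose images satisfy G: if J is
   infinite, then the images of x |` J are images of J. *)
Lemma chain_union_ind {T : Type} (G : set (set T)) :
  (forall J, finite_set J -> G J) ->
  (forall CC, CC !=set0 -> CC `<=` G -> total_on CC subset ->
    G (\bigcup_(J in CC) J)) ->
  G setT.
Proof.
move=> Gfin Gchain.
have [|J [GJ maxJ]] :=
  @Zorn_bigcup T [set J | forall f : T -> T, G (f @` J)].
  move=> CC sCC totCC f; rewrite image_bigcup.
  have [->|/set0P CC0] := eqVneq CC set0; first by rewrite bigcup_set0; exact: Gfin.
  rewrite -[X in G X](_ : \bigcup_(J in [set f @` K | K in CC]) J = _); last first.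
    by rewrite bigcup_image.
  apply: Gchain.
  - by case: CC0 => K CCK; exists (f @` K), K.
  - by move=> _ [K /sCC GK <-]; exact: GK.
  - move=> _ _ [K CK <-] [L CL <-].
    by case: (totCC K L CK CL) => KL; [left|right]; exact: image_subset.
suff JT : J = setT by move: (GJ id); rewrite image_id JT.
apply/seteqP; split=> // x _; apply: contrapT => Jx.
apply: (maxJ (x |` J)).
  by split; [exact: subsetUr|move=> /(_ x (or_introl erefl))].
move=> f; have [finJ|/(infinite_setU1_image _ x)[h <-]] := pselect (finite_set J).
  by apply: Gfin; apply: finite_image; rewrite finite_setU.
by rewrite image_comp.
Qed.

(** * Directed families and monotone nets *)

Lemma directed_lower_bound {U : Type} (AA XX : set (set U)) :
  AA !=set0 -> down_directed AA -> finite_set XX -> XX `<=` AA ->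
  exists2 A, AA A & forall B, XX B -> A `<=` B.
Proof.
move=> [A0 AA0] dirAA /finite_seqP[s ->].
elim: s => [|B s ih] sAA; first by exists A0.
case: ih => [C Cs|A AA_A As]; first by apply: sAA; rewrite /= inE Cs orbT.
have [|C AA_C CAB] := dirAA A B AA_A; first by apply: sAA; rewrite /= inE eqxx.
exists C => // D; rewrite /= inE => /orP[/eqP->|/As AD] x /CAB[] //.
by move=> /AD.
Qed.

Lemma total_down_directed {U : Type} (AA : set (set U)) :
  total_on AA subset -> down_directed AA.
Proof.
move=> tot A B AA_A AA_B.
by case: (tot A B AA_A AA_B) => s; [exists A|exists B] => // x Ax; split=> //; exact: s.
Qed.

Lemma finite_subset_chain_bigcup {T : Type} (CC : set (set T)) (X : set T) :
  CC !=set0 -> total_on CC subset -> finite_set X ->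
  X `<=` \bigcup_(J in CC) J -> exists2 J, CC J & X `<=` J.
Proof.
move=> CC0 totCC /(@finite_seqP {classic T})[s ->] {X}.
elim: s => [|x s ih] sCC; first by case: CC0 => J CCJ; exists J.
have [|J CCJ sJ] := ih; first by move=> y ys; apply: sCC; rewrite /= inE ys orbT.
have [|K CCK Kx] := sCC x; first by rewrite /= inE eqxx.
have [JK|KJ] := totCC _ _ CCJ CCK; [exists K|exists J] => // y;
  rewrite /= inE => /orP[/eqP-> //|/sJ //]; [exact: JK|exact: KJ].
Qed.

(** Recursion on proper inclusion of finite sets: [phi F] is a chosen lower bound in [AA] of the
    members of [F] and of all earlier values [phi G], with [G] a proper subset of [F]. These are
    finitely many sets, so directedness provides the bound. *)
Lemma directed_net {U : Type} (AA : set (set U)) :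
  AA !=set0 -> down_directed AA ->
  exists phi : {fset set U} -> set U, forall F, [set` F] `<=` AA ->
    [/\ AA (phi F), forall A, A \in F -> phi F `<=` A &
        forall G, (G `<=` F)%fset -> phi F `<=` phi G].
Proof.
move=> AA0 dirAA.
have /choice[lb lbP] : forall XX : set (set U), exists A,
    finite_set XX -> XX `<=` AA -> AA A /\ forall B, XX B -> A `<=` B.
  move=> XX; have [[finX sX]|nX] := pselect (finite_set XX /\ XX `<=` AA).
    by have [A ? ?] := directed_lower_bound _ _ AA0 dirAA finX sX; exists A.
  (* [set0] is a dummy value, for arguments that are infinite or not within [AA]. *)
  by exists set0 => ? ?; case: nX.
have wf : well_founded (fun G F : {fset set U} => is_true (G `<` F)%fset).
  suff acc n (F : {fset set U}) :
      (#|` F| < n)%N -> Acc (fun G F => is_true (G `<` F)%fset) F.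
    by move=> F; exact: (acc _ F (ltnSn _)).
  elim: n F => [//|n ih] F; rewrite ltnS => Fn.
  constructor=> G GF; apply: ih.
  by apply: leq_trans Fn; exact: fproper_ltn_card.
pose step (F : {fset set U}) (rec : forall G, (G `<` F)%fset -> set U) : set U :=
  lb ([set` F] `|` [set A | exists G (h : (G `<` F)%fset), A = rec G h]).
pose phi := Fix wf (fun _ => set U) step.
have phiE F : phi F = lb ([set` F] `|` phi @` [set G | (G `<` F)%fset]).
  rewrite /phi Fix_eq; last first.
    move=> F' f g fg; congr (step _ _).
    by apply: functional_extensionality_dep => G; apply: functional_extensionality_dep.
  rewrite /step; congr (lb (_ `|` _)); apply/seteqP; split=> A.
    by move=> [G [h ->]]; exists G.
  by move=> [G h <-]; exists G, h.
suff phiP F : [set` F] `<=` AA -> AA (phi F) /\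
    forall B, ([set` F] `|` phi @` [set G | (G `<` F)%fset]) B -> phi F `<=` B.
  exists phi => F /phiP[AAF lbF]; split=> //.
    by move=> A AF; apply: lbF; left.
  move=> G; rewrite fsubEproper => /orP[/eqP-> //|GF].
  by apply: lbF; right; exists G.
elim/(well_founded_ind wf): F => F ih FAA; rewrite phiE; apply: lbP.
  rewrite finite_setU; split=> //; apply: finite_image.
  apply: (@sub_finite_set _ _ [set` fpowerset F]) => // G /= /fproper_sub GF.
  by rewrite fpowersetE.
move=> A [/FAA//|[G /= GF <-]]; apply: (ih G GF _).1.
by move=> B /= BG; apply: FAA; exact: (fsubsetP (fproper_sub GF)).
Qed.

(** * One-local retracts in terms of balls *)

(** The point [a] is to be the image of [x] under a retraction that fixes [A]. It lies in every ball
    centered in [A] that contains [x]. *)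
Definition ball_retract {U : Type} (E : brs U) (A : set U) : Prop :=
  forall x, carrier E x -> exists2 a, A a &
    forall y r, A y -> rels E r -> r (y, x) -> r (y, a).

(* D is an intersection of A with balls centered in A. *)
Definition ball_closed {U : Type} (E : brs U) (A D : set U) : Prop :=
  D `<=` A /\ forall y, A y ->
    (forall x r, A x -> rels E r -> (forall z, D z -> r (x, z)) -> r (x, y)) ->
    D y.

Lemma brs_eq {U : Type} (E F : brs U) :
  carrier E = carrier F -> rels E = rels F -> E = F.
Proof.
case: E F => [c r p] [c' r' p'] /= ce re; case: c' / ce p' => p'.
by case: r' / re p' => p'; congr Brs; exact: Prop_irrelevance.
Qed.

(** A retraction [g] yields [a := g x]. Conversely, fix [A] and send all else to [a]: pairs from [A]
    to [x] are preserved by the choice of [a], pairs from [x] to [A] by passing to the inverse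
    relation, and the pair of [x] with itself by reflexivity. *)
Lemma one_local_retractP {U : Type} (E : brs U) (A : set U) :
  rel_involutive E -> rel_reflexive E -> A `<=` carrier E ->
  one_local_retract E A <-> ball_retract E A.
Proof.
move=> Einv Eref AE; split=> AR x Ex.
  have [g [[gfun gr] gg] eqA] := AR x Ex.
  have {eqA} gA : A = g @` (A `|` [set x]) by exact: (congr1 (@carrier _) eqA).
  have Agx : A (g x) by rewrite gA; exists x => //; right.
  exists (g x) => // y r Ay Er ryx.
  have gy : g y = y by move: (Ay); rewrite {1}gA => -[z Az <-]; exact: gg.
  have := gr (r `&` ((A `|` [set x]) `*` (A `|` [set x]))) _ y x.
  rewrite gy => -[]; first by exists r.
  - by split=> //; split; [left|right].
  - by [].
have [a Aa aP] := AR x Ex.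
pose g y := if pselect (A y) then y else a.
have gid y : A y -> g y = y by rewrite /g; case: pselect.
have ga y : ~ A y -> g y = a by rewrite /g; case: pselect.
have gA y : A (g y) by rewrite /g; case: pselect.
have gim : g @` (A `|` [set x]) = A.
  apply/seteqP; split=> [_ [y _ <-] //|y Ay].
  by exists y; [left|exact: gid].
exists g; last first.
  apply: brs_eq; rewrite /= ?gim //; apply/seteqP; split=> s.
    move=> [r Er <-]; exists (r `&` ((A `|` [set x]) `*` (A `|` [set x]))).
      by exists r.
    rewrite -setIA; congr (_ `&` _); apply: setIidr.
    by move=> -[u v] [Au Av]; split; left.
  move=> [_ [r Er <-] <-]; exists r => //.
  rewrite -setIA; congr (_ `&` _); apply/esym/setIidr.
  by move=> -[u v] [Au Av]; split; left.
split; last by move=> y _; exact: gid.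
split; first by move=> y _; left; exact: gA.
move=> _ [r Er <-] y z [ryz [yA zA]]; split; last by split; left; exact: gA.
have [Ay|nAy] := pselect (A y); have [Az|nAz] := pselect (A z).
- by rewrite !gid.
- case: zA => [//|zx]; rewrite gid // ga //; apply: aP => //.
  by rewrite -zx.
- case: yA => [//|yx]; rewrite ga // gid //.
  apply: (aP z (r^-1)%relation) => //; first exact/(Einv r).
  by rewrite /= -yx.
- by rewrite !ga //; apply: Eref => //; exact: AE.
Qed.

(** * Intersections of chains, by compactness and normality *)

Section ChainOfRetracts.
Variables (U : Type) (E : brs U).
Hypothesis Einv : rel_involutive E.
Hypotheses (Ecompact : compact_structure E) (Enormal : normal_structure E).


Lemma ball_closed_meet (A D D' : set U) :
  ball_closed E A D -> ball_closed E A D' -> ball_closed E A (D `&` D').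
Proof.
move=> [DA clD] [_ clD']; split=> [y [/DA]//|y Ay yP].
split; [apply: clD|apply: clD'] => // x r Ax Er xr; apply: yP => // z [] Dz Dz';
  exact: xr.
Qed.

Lemma ball_closed_ball (A : set U) x r :
  A x -> rels E r -> ball_closed E A [set y | A y /\ r (x, y)].
Proof.
move=> Ax Er; split=> [y []//|y Ay yP]; split=> //.
by apply: yP => // z [].
Qed.

Lemma ball_closed_bigcap (A : set U) (DD : set (set U)) :
  DD !=set0 -> (forall D, DD D -> ball_closed E A D) ->
  ball_closed E A (\bigcap_(D in DD) D).
Proof.
move=> [D0 DD0] clD; split=> [y /(_ _ DD0)|y Ay yP D DD_D].
  exact: (clD _ DD0).1.
apply: (clD _ DD_D).2 => // x r Ax Er xr; apply: yP => // z /(_ _ DD_D).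
exact: xr.
Qed.

(** Compactness is applied to the balls centered in [A] that contain some member of [DD]: finitely
    many of them contain a common member. The resulting point of [E] is then replaced by a point of
    [A] in the same balls, which lies in every [D] because [D] is cut out of [A] by such balls. *)
Lemma ball_closed_chain (A : set U) (DD : set (set U)) :
  A `<=` carrier E -> ball_retract E A -> DD !=set0 -> total_on DD subset ->
  (forall D, DD D -> ball_closed E A D /\ D !=set0) ->
  \bigcap_(D in DD) D !=set0.
Proof.
move=> AE AR DD0 totDD clDD.
pose FF := [set B | exists x r, [/\ A x, rels E r, B = rball E x r &
  exists2 D, DD D & D `<=` B]].
have [||x [Ex FFx]] := Ecompact FF.
- by move=> B [x [r [Ax Er -> _]]]; exists x, r; split=> //; exact: AE.
- move=> GG finGG GGF.
  have /choice[d dP] : forall B, exists D, GG B -> DD D /\ D `<=` B.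
    move=> B; have [/GGF|nB] := pselect (GG B); last by exists set0.
    by move=> [? [? [_ _ _ [D ? ?]]]]; exists D.
  have [|D DD_D DGG] := directed_lower_bound DD (d @` GG) DD0
      (total_down_directed _ totDD) (finite_image _ finGG).
    by move=> _ [B /dP[? _] <-].
  have [[DA _] [y Dy]] := clDD _ DD_D.
  exists y; split; first exact/AE/DA.
  move=> B GGB; apply: (dP _ GGB).2; apply: DGG Dy.
  by exists B.
have [a Aa aP] := AR _ Ex; exists a => D DD_D.
apply: (clDD _ DD_D).1.2 => // y r Ay Er Dr; apply: aP => //.
have /FFx[] // : FF (rball E y r).
exists y, r; split=> //; exists D => // z Dz; split; last exact: Dr.
exact/AE/(clDD _ DD_D).1.1.
Qed.

Lemma equally_centered_closed_singleton (A D : set U) :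
  A `<=` carrier E -> ball_retract E A -> ball_closed E A D -> D !=set0 ->
  (forall x r, D x -> rels E r -> (forall z, D z -> r (x, z)) ->
    forall y z, D y -> D z -> r (y, z)) ->
  exists d, D = [set d].
Proof.
move=> AE AR [DA clD] [d Dd] ecD.
(* X is the trace on E of the balls containing D, a member of ball_meets E that
   inherits from D the property of being equally centered. *)
pose X := meet_in E [set B | balls E B /\ D `<=` B].
have DX : D `<=` X by move=> z Dz; split; [exact/AE/DA|move=> B [_]; exact].
have XP x r z : carrier E x -> rels E r -> (forall w, D w -> r (x, w)) ->
    X z -> r (x, z).
  move=> Ex Er xr [_ /(_ (rball E x r))[] //]; split; first by exists x, r.
  by move=> w Dw; split; [exact/AE/DA|exact: xr].
suff [y Xy] : exists y, X = [set y].
  exists d; apply/seteqP; split=> [z /DX|_ -> //].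
  by move: (DX _ Dd); rewrite Xy => /= -> ->.
apply: contrapT => nX; apply: (Enormal X) => //.
  by exists [set B | balls E B /\ D `<=` B] => // B [].
apply/seteqP; split=> r [Er rP]; split=> //; last first.
  exists d; first exact: DX.
  by move=> z Xz; split; [case: Xz|apply: rP; split=> //; exact: DX].
move: rP => [x Xx Xr] [u v] [/= Xu Xv].
have Ex : carrier E x by case: Xx.
have ErV : rels E (r^-1)%relation by apply/(Einv r).
(* The center [x] of [X] may lie outside [A]. Its substitute [a] lies in every ball centered in [A]
   that contains [D], hence in [D], and is still a center of radius [r] for [D]. *)
have [a Aa aP] := AR x Ex.
have Da : D a.
  apply: clD => // y s Ay Es ys; apply: aP => //.
  by apply: XP Xx => //; exact: AE.
have ar z : D z -> r (a, z).
  move=> Dz; apply: (aP z (r^-1)%relation) => //; first exact: DA.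
  by case: (Xr _ (DX _ Dz)).
have Dr := ecD a r Da Er ar.
(* The inclusion in [r] passes from pairs in [D] to pairs in [X] one coordinate at a time, the first
   coordinate through the inverse of [r]. *)
apply: (XP _ _ _ _ Er _ Xv); first by case: Xu.
move=> w Dw; apply: (XP w (r^-1)%relation) Xu => //; first exact/AE/DA.
by move=> z Dz /=; exact: Dr.
Qed.

Lemma chain_of_retracts (AA : set (set U)) :
  AA !=set0 -> total_on AA subset ->
  (forall A, AA A -> A `<=` carrier E) ->
  (forall A, AA A -> ball_retract E A) ->
  ball_retract E (meet_in E AA).
Proof.
move=> [A0 AA0] totAA AAE AAR x0 Ex0.
set P := meet_in E AA.
have PA A : AA A -> P `<=` A by move=> AA_A y [_]; apply.
(* [C] collects the admissible images of [x0]; the task is to find one of them in [P]. *)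
pose C := [set y | forall p r, P p -> rels E r -> r (p, x0) -> r (p, y)].
suff [d Pd Cd] : exists2 d, P d & C d by exists d => // y r Py Er; exact: Cd.
pose net (D : set U -> set U) := forall A, AA A -> [/\ D A `<=` C,
  ball_closed E A (D A), D A !=set0 &
  forall B, AA B -> A `<=` B -> D A `<=` D B].
(* The starting family: [A] meets [C] because [A] is a ball retract and the centers defining [C] lie
   in [P], hence in [A]. *)
have net0 : net (fun A => A `&` C).
  move=> A AA_A; split.
  - by move=> y [].
  - split=> [y []//|y Ay yP]; split=> // p r Pp Er rpx.
    by apply: yP => //; [exact: PA Pp|move=> z [_]; exact].
  - have [a Aa aP] := AAR _ AA_A _ Ex0; exists a; split=> // p r Pp Er.
    by apply: aP => //; exact: PA Pp.
  - by move=> B _ AB y [/AB By Cy].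
(* The order is reversed inclusion, so that a maximal element for [R] is a minimal family. *)
pose R (s t : {D | net D}) := `[< forall A, AA A -> sval t A `<=` sval s A >].
have [|||[D netD] minD] := ZL_preorder (exist _ _ net0) (R := R).
- by move=> t; apply/asboolP => A _.
- move=> r s t /asboolP rs /asboolP st; apply/asboolP => A AA_A.
  exact: subset_trans (st _ AA_A) (rs _ AA_A).
- move=> DD totDD; have [->|/set0P[t0 DDt0]] := eqVneq DD set0.
    by exists (exist _ _ net0).
  pose DA (A : set U) := [set sval t A | t in DD].
  (* The pointwise intersection bounds a chain of families; its values are nonempty by
     [ball_closed_chain], that is, by compactness. *)
  have netM : net (fun A => \bigcap_(X in DA A) X).
    move=> A AA_A; have DA0 : DA A !=set0 by exists (sval t0 A), t0.
    have clDA X : DA A X -> ball_closed E A X /\ X !=set0.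
      by move=> [t _ <-]; have [] := svalP t A AA_A.
    split.
    - move=> y /(_ (sval t0 A))yP; have [+ _ _ _] := svalP t0 A AA_A.
      by apply; apply: yP; exists t0.
    - by apply: ball_closed_bigcap => // X /clDA[].
    - apply: (ball_closed_chain A) => //; [exact: AAE|exact: AAR|].
      move=> _ _ [s DDs <-] [t DDt <-].
      by case: (totDD s t DDs DDt) => /asboolP st; [right|left]; exact: st.
    - move=> B AA_B AB y yP _ [t DDt <-].
      have [_ _ _ /(_ B AA_B AB)] := svalP t A AA_A; apply.
      by apply: yP; exists t.
  exists (exist _ _ netM) => s DDs; apply/asboolP => A AA_A y /=; apply.
  by exists s.
have {}minD D' : net D' -> (forall A, AA A -> D' A `<=` D A) ->
    forall A, AA A -> D A `<=` D' A.
  move=> netD' D'D; apply/asboolP.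
  by apply: (minD (exist _ _ netD')); apply/asboolP.
have clD A : AA A -> ball_closed E A (D A) by case/netD.
have monoD A B : AA A -> AA B -> A `<=` B -> D A `<=` D B.
  by move=> /netD[_ _ _ +]; exact.
have DA A : AA A -> D A `<=` A by case/clD.
(* D(A') cut down to the ball of center x and radius r is again such a family:
   for A' below B nothing changes, and for A' above B it contains D(B). *)
have cover A B x r : AA A -> AA B -> B x -> rels E r ->
    (forall z, D B z -> r (x, z)) -> forall z, D A z -> r (x, z).
  move=> AA_A AA_B Bx Er xr z DAz.
  suff netD' : net (fun A => D A `&` [set y | r (x, y)]).
    by have [B' _ y []|] := minD _ netD' _ A AA_A z DAz.
  move=> {z DAz}A' {}AA_A'.
  have [AC cl [y Dy] _] := netD _ AA_A'; split.
  - by move=> z [/AC].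
  - have [A'B|BA'] := totAA _ _ AA_A' AA_B.
      rewrite setIidl // => z /(monoD _ _ AA_A' AA_B A'B); exact: xr.
    rewrite (_ : _ `&` _ = D A' `&` [set y | A' y /\ r (x, y)]).
      by apply: ball_closed_meet => //; apply: ball_closed_ball => //; exact: BA'.
    apply/seteqP; split=> w [Dw]; first by split=> //; split=> //; exact: cl.1.
    by move=> [].
  - have [A'B|BA'] := totAA _ _ AA_A' AA_B.
      by exists y; split=> //; apply: xr; exact: monoD A'B _ Dy.
    have [_ _ [w Dw] _] := netD _ AA_B.
    by exists w; split; [exact: monoD BA' _ Dw|exact: xr].
  - by move=> B' AA_B' AB' w [Dw rw]; split=> //; exact: monoD AB' _ Dw.
(* The centers in D(B) of the balls of radius r containing D(B), for varying B,
   again form such a family. *)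
have ecD A x r : AA A -> D A x -> rels E r -> (forall z, D A z -> r (x, z)) ->
    forall y z, D A y -> D A z -> r (y, z).
  move=> AA_A DAx Er xr y z Dy.
  suff : D A `<=` [set w | D A w /\ forall z, D A z -> r (w, z)].
    by move=> /(_ y Dy)[_]; exact.
  apply: (minD (fun B => [set w | D B w /\ forall z, D B z -> r (w, z)])) => //;
    last by move=> B _ w [].
  have ErV : rels E (r^-1)%relation by apply/(Einv r).
  move=> B AA_B; have [BC cl B0 _] := netD _ AA_B; split.
  - by move=> w [/BC].
  - split=> [w [/cl.1//]|w Bw wP]; split.
      apply: cl.2 => // u s Bu Es us; apply: wP => // v [Dv _]; exact: us.
    move=> u Du; apply: (wP u (r^-1)%relation) => //; first exact: DA Du.
    by move=> v [_]; exact.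
  - have [AB|BA] := totAA _ _ AA_A AA_B.
      exists x; split; first exact: monoD AB _ DAx.
      by apply: cover Er xr => //; exact: DA DAx.
    (* For [B] below [A] the center [x] may fall outside [B]. Its substitute [b] lies in [D B]: by
       [cover], a ball centered in [B] that contains [D B] contains [D A], hence [x], hence [b]. *)
    have [b Bb bP] := AAR _ AA_B x (AAE _ AA_A _ (DA _ AA_A _ DAx)).
    exists b; split.
      apply: cl.2 => // u s Bu Es us; apply: bP => //.
      exact: (cover A B u s).
    move=> w Dw; apply: (bP w (r^-1)%relation) => //; first exact: DA Dw.
    by apply: xr; exact: monoD BA _ Dw.
  - move=> B' AA_B' BB' w [Dw wr]; split; first exact: monoD BB' _ Dw.
    by apply: cover Er wr => //; exact: DA Dw.
have sing A : AA A -> exists d, D A = [set d].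
  move=> AA_A; have [_ cl D0 _] := netD _ AA_A.
  apply: (equally_centered_closed_singleton A) => //; [exact: AAE|exact: AAR|].
  by move=> x r Dx Er xr y z; exact: (ecD A x r).
(* Since [D] is monotone on a chain and all its values are singletons, they equal the one at [A0];
   so [d] belongs to every [A]. *)
have [d dA0] := sing _ AA0.
have DA0d : D A0 d by rewrite dA0.
exists d; last by have [+ _ _ _] := netD _ AA0; apply.
split; first exact/(AAE _ AA0)/(DA _ AA0).
move=> A AA_A; apply: (DA A) => //; have [e dA] := sing _ AA_A.
have [A0A|AA0'] := totAA _ _ AA0 AA_A; first exact: monoD A0A _ DA0d.
have : D A0 e by apply: monoD AA0' _ _ => //; rewrite dA.
by rewrite dA0 dA => ->.
Qed.

End ChainOfRetracts.

(** * From chains to directed families *)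

Theorem theorem3p5 (U : Type) (E : brs U) (AA : set (set U))
    (Einvolutive : rel_involutive E)
    (Ereflexive : rel_reflexive E)
    (Ecompact : compact_structure E)
    (Enormal : normal_structure E)
    (AA_sub : forall A, AA A -> A `<=` carrier E)
    (AA_directed : down_directed AA)
    (AA_retract : forall A, AA A -> one_local_retract E A) :
  one_local_retract E (meet_in E AA).
Proof.
have AAR A : AA A -> ball_retract E A.
  by move=> AA_A; apply/one_local_retractP; [| |exact: AA_sub|exact: AA_retract].
apply/one_local_retractP => //; first by move=> x [].
(* The empty family has [E] as its meet, where each [x] serves as its own image. *)
have [->|/set0P AA0] := eqVneq AA set0.
  by move=> x Ex; exists x => //; split=> // B [].
have [phi phiP] := directed_net AA AA0 AA_directed.
(* [R J] consists of the net values at finite subsets of [AA] with members in [J]. The meet over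
   [R setT] is the one over [AA], since [phi] at the singleton of [A] is included in [A]. *)
pose R J := [set phi F | F in [set F | [set` F] `<=` AA `&` J]].
have RAA J : R J `<=` AA.
  by move=> _ [F FJ <-]; have [|] := phiP F; first by move=> A /FJ[].
suff RT : ball_retract E (meet_in E (R setT)).
  rewrite (_ : meet_in E AA = meet_in E (R setT)) //.
  apply/seteqP; split=> x [Ex xP]; split=> // A; first by move=> /RAA; exact: xP.
  move=> AA_A; have FA : [set` [fset A]%fset] `<=` AA.
    by move=> B /=; rewrite in_fset1 => /eqP->.
  have [_ /(_ A) + _] := phiP _ FA; apply; first by rewrite in_fset1.
  by apply: xP; exists [fset A]%fset => // B /FA.
apply: (chain_union_ind (fun J => ball_retract E (meet_in E (R J)))).
  move=> J finJ.
  have /finite_fsetP[F FJ] : finite_set (AA `&` J) by exact: finite_setIr.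
  have FAA : [set` F] `<=` AA by rewrite -FJ; exact: subIsetl.
  have [phiF _ phimono] := phiP _ FAA.
  (* For finite [J] there is a largest index [F], so by monotonicity of the net [phi F] is the least
     member of [R J]. *)
  rewrite (_ : meet_in E (R J) = phi F); first exact: AAR.
  apply/seteqP; split=> [x [_]|x phix].
    by apply; exists F => //=; rewrite FJ.
  split; first exact: AA_sub phix.
  move=> _ [G GJ <-]; apply: phimono phix; apply/fsubsetP => A /GJ.
  by rewrite FJ.
move=> CC CC0 CCR totCC.
have RS J K : J `<=` K -> R J `<=` R K.
  move=> JK _ [F FJ <-]; exists F => // A /FJ[AA_A JA]; split=> //.
  exact: JK.
have meetRS J K : J `<=` K -> meet_in E (R K) `<=` meet_in E (R J).
  by move=> JK x [Ex xP]; split=> // B /(RS _ _ JK); exact: xP.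
(* A finite subset of the union of the chain [CC] lies in one of its members, so [R] commutes with
   this union, and the meets over the [R J] form a chain of ball retracts. *)
rewrite (_ : meet_in E _ = meet_in E [set meet_in E (R J) | J in CC]).
  apply: chain_of_retracts => //.
  - by case: CC0 => J CCJ; exists (meet_in E (R J)), J.
  - move=> _ _ [J CCJ <-] [K CCK <-].
    by have [JK|KJ] := totCC _ _ CCJ CCK; [right|left]; exact: meetRS.
  - by move=> _ [J _ <-] x [].
  - by move=> _ [J /CCR JR <-].
apply/seteqP; split=> x [Ex xP]; split=> //.
  move=> _ [J CCJ <-]; apply: (meetRS J (\bigcup_(J in CC) J)); last by split.
  exact: bigcup_sup.
move=> _ [F FCC <-].
have [||J CCJ FJ] := finite_subset_chain_bigcup CC [set` F] CC0 totCC.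
- exact: finite_fset.
- by move=> A /FCC[].
have [_] := xP _ (imageP _ CCJ); apply; exists F => // A FA; split; last exact: FJ.
by have [] := FCC A FA.
Qed.
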